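(* Let $M$ be a $(2n+1)$-dimensional $N(\kappa)$-contact metric manifold satisfying $\mathcal{T}(\xi,X_1).R=0$ for all vector fields $X_1$ on $M$. If $C=a_1+a_5\neq0$, then $$S=\frac{A}{C}\,g+\frac{B}{C}\,\eta\otimes\eta,\qquad A=-2n\kappa(a_2+a_4),\quad B=2n\kappa(a_1+a_2+a_4+a_5).$$ Therefore $M$ is an $\eta$-Einstein manifold. Consequently, for $\mathcal{T}$ equal to each of the following special tensors (with the corresponding $C\ne0$), the condition $\mathcal{T}(\xi,X_1).R=0$ for all $X_1$ implies: - $\mathcal{P}_\star,\mathcal{W}_1,\mathcal{W}_1^\star,\mathcal{W}_2,\mathcal{W}_5,\mathcal{W}_7$: $M$ is Einstein with $S=2n\kappa\,g$; - $\mathcal{W}_4,\mathcal{W}_6,\mathcal{W}_8$: $M$ is $\eta$-Einstein with $S=2n\kappa\,\eta\otimes\eta$.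
   Context: A contact metric manifold $(M^{2n+1},\varphi,\xi,\eta,g)$ satisfies $\varphi^2=-I+\eta\otimes\xi$, $\eta(\xi)=1$, $\varphi\xi=0$, $\eta\circ\varphi=0$, $g(\varphi X,\varphi Y)=g(X,Y)-\eta(X)\eta(Y)$, $d\eta(X,Y)=g(X,\varphi Y)$; put $h=\tfrac12\mathcal{L}_\xi\varphi$. It is an $N(\kappa)$-contact metric manifold ($\kappa$ a real constant) if $R(X,Y)\xi=\kappa[\eta(Y)X-\eta(X)Y]$ for all $X,Y$, where $R(X,Y)Z=\nabla_X\nabla_YZ-\nabla_Y\nabla_XZ-\nabla_{[X,Y]}Z$. $S$, $Q$, $r$ denote the Ricci tensor, the Ricci operator ($S(X,Y)=g(QX,Y)$) and the scalar curvature. $M$ is $\eta$-Einstein if $S=b_1g+b_2\,\eta\otimes\eta$ with $b_1,b_2$ smooth functions, and Einstein if moreover $b_2=0$. Standing formulas the paper uses for every $N(\kappa)$-contact metric manifold considered: $S(X,Y)=2(n-1)g(X,Y)+2(n-1)g(hX,Y)+[2n\kappa-2(n-1)]\eta(X)\eta(Y)$, $S(X,\xi)=2n\kappa\,\eta(X)$, $r=2n(2n-2+\kappa)$. The $\mathcal{T}$-curvature tensor with coefficients $a_0,\dots,a_7$ (smooth functions on $M$) is $$\mathcal{T}(X_1,X_2)X_3=a_0R(X_1,X_2)X_3+a_1S(X_2,X_3)X_1+a_2S(X_1,X_3)X_2+a_3S(X_1,X_2)X_3+a_4g(X_2,X_3)QX_1+a_5g(X_1,X_3)QX_2+a_6g(X_1,X_2)QX_3+a_7r\bigl(g(X_2,X_3)X_1-g(X_1,X_3)X_2\bigr).$$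 The derivation action is $(\mathcal{T}(X_1,X_2).R)(X_3,X_4)X_5=\mathcal{T}(X_1,X_2)R(X_3,X_4)X_5-R(\mathcal{T}(X_1,X_2)X_3,X_4)X_5-R(X_3,\mathcal{T}(X_1,X_2)X_4)X_5-R(X_3,X_4)\mathcal{T}(X_1,X_2)X_5$. Special cases (coefficients not listed are $0$; $a_0=1$ except for $\mathcal{P}_\star$, where $a_0,a_1$ are free): $\mathcal{P}_\star$ (pseudo-projective): $a_1=-a_2$, $a_7=-\frac1{2n+1}(\frac{a_0}{2n}+a_1)$; $\mathcal{W}_1$: $a_1=-a_2=\frac1{2n}$; $\mathcal{W}_1^\star$: $a_1=-a_2=-\frac1{2n}$; $\mathcal{W}_2$: $a_4=-a_5=-\frac1{2n}$; $\mathcal{W}_4$: $a_5=-a_6=\frac1{2n}$; $\mathcal{W}_5$: $a_2=-a_5=-\frac1{2n}$; $\mathcal{W}_6$: $a_1=-a_6=-\frac1{2n}$; $\mathcal{W}_7$: $a_1=-a_4=-\frac1{2n}$; $\mathcal{W}_8$: $a_1=-a_3=-\frac1{2n}$. *)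

(* Defs.v *)
From HB Require Import structures.
From mathcomp Require Import all_boot all_order all_algebra.
From mathcomp Require Import all_classical all_reals all_analysis.
From mathcomp Require Import ring.

Set Implicit Arguments.
Unset Strict Implicit.
Unset Printing Implicit Defensive.

Import Order.TTheory GRing.Theory Num.Theory.
Import numFieldNormedType.Exports.

Local Open Scope classical_set_scope.
Local Open Scope ring_scope.

Section SmoothOnOpenSets.
Context {R : realType} {m : nat}.
Implicit Types (U : set 'rV[R]_m) (f g : 'rV[R]_m -> R).

(* Meaningful for open U only: the partial derivatives at a point of U then
   depend only on the restriction of f to U. *)
Fixpoint Ck (k : nat) U f : Prop :=
  (forall x, U x -> {for x, continuous f}) /\
  if k is k'.+1 then
    forall i : 'I_m, (forall x, U x -> derivable f x (delta_mx 0 i)) /\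
      Ck k' U (fun x => 'D_(delta_mx 0 i) f x)
  else True.

Definition smooth_on U f := forall k, Ck k U f.

Lemma Ck_cont k U f x : Ck k U f -> U x -> {for x, continuous f}.
Proof. by case: k => [|k] [+ _]; apply. Qed.

Lemma Ck_ext k U f g : open U -> (forall x, U x -> f x = g x) ->
  Ck k U f -> Ck k U g.
Proof.
move=> oU.
have near f0 g0 x : (forall x, U x -> f0 x = g0 x) -> U x ->
    \forall y \near x, f0 y = g0 y.
  by move=> fg Ux; apply: filterS fg _; exact: open_nbhs_nbhs.
have cont f0 g0 : (forall x, U x -> f0 x = g0 x) ->
    (forall x, U x -> {for x, continuous f0}) ->
    forall x, U x -> {for x, continuous g0}.
  move=> fg cf x Ux; rewrite /prop_for /continuous_at -(fg _ Ux).
  exact: cvg_trans (near_eq_cvg (F := nbhs x) (near _ _ _ fg Ux)) (cf x Ux).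
elim: k f g => [|k IH] f g fg [cf df]; split=> //; try exact: cont fg cf.
move=> i; have [di ci] := df i; split.
  by move=> x Ux; exact: near_eq_derivable (near _ _ _ fg Ux) (di x Ux).
by apply: IH ci => x Ux; apply: near_eq_derive; exact: near fg Ux.
Qed.

Lemma Ck_le k U f : Ck k.+1 U f -> Ck k U f.
Proof.
elim: k f => [|k IH] f [cf df]; first by [].
by split=> // i; have [di ci] := df i; split=> //; exact: IH.
Qed.

Lemma Ck_cst k U c : Ck k U (fun=> c).
Proof.
elim: k c => [|k IH] c; split=> //; try by move=> x _; exact: cst_continuous.
move=> i; split; first by move=> x _; exact: derivable_cst.
have -> : (fun x => 'D_(delta_mx 0 i) (fun _ : 'rV[R]_m => c) x) = fun=> 0.
  by apply/funext => x; exact: derive_cst.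
exact: IH.
Qed.

Lemma CkD k U f g : open U -> Ck k U f -> Ck k U g -> Ck k U (f + g).
Proof.
move=> oU; elim: k f g => [|k IH] f g [cf df] [cg dg].
  by split=> // x Ux; exact: (@cvgD _ _ _ (nbhs x) _ f g _ _ (cf x Ux) (cg x Ux)).
split=> [x Ux|i]; first by exact: (@cvgD _ _ _ (nbhs x) _ f g _ _ (cf x Ux) (cg x Ux)).
have [dfi cfi] := df i; have [dgi cgi] := dg i; split.
  by move=> x Ux; apply: derivableD; [exact: dfi|exact: dgi].
apply: Ck_ext oU _ (IH _ _ cfi cgi) => x Ux.
by rewrite deriveD //; [exact: dfi|exact: dgi].
Qed.

Lemma CkM k U f g : open U -> Ck k U f -> Ck k U g -> Ck k U (f * g).
Proof.
move=> oU; elim: k f g => [|k IH] f g Hf Hg;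
  have cfg x : U x -> {for x, continuous (f * g)}.
1,3: by move=> Ux;
  exact: (@cvgM _ _ (nbhs x) _ f g _ _ (Ck_cont Hf Ux) (Ck_cont Hg Ux)).
  by [].
split=> // i; move: (Hf) (Hg) => [_ /(_ i) [dfi cfi]] [_ /(_ i) [dgi cgi]].
split; first by move=> x Ux; apply: derivableM; [exact: dfi|exact: dgi].
have := CkD oU (IH _ _ (Ck_le Hf) cgi) (IH _ _ (Ck_le Hg) cfi).
apply: Ck_ext oU _ => x Ux.
by rewrite deriveM //; [exact: dfi|exact: dgi].
Qed.

End SmoothOnOpenSets.

Record chart (R : realType) (m : nat) (T : topologicalType) := Chart {
  chart_dom : set T;
  chart_img : set 'rV[R]_m;
  chart_map : T -> 'rV[R]_m;
  chart_inv : 'rV[R]_m -> T;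
  chart_dom_open : open chart_dom;
  chart_img_open : open chart_img;
  chart_map_img : forall p, chart_dom p -> chart_img (chart_map p);
  chart_inv_dom : forall x, chart_img x -> chart_dom (chart_inv x);
  chart_mapK : forall p, chart_dom p -> chart_inv (chart_map p) = p;
  chart_invK : forall x, chart_img x -> chart_map (chart_inv x) = x;
  chart_map_cont : forall p, chart_dom p -> {for p, continuous chart_map};
  chart_inv_cont : forall x, chart_img x -> {for x, continuous chart_inv} }.

(* The transition map c2 o c1^-1, on the part of the image of c1 where it is
   defined, has smooth components. *)
Definition smooth_transition (R : realType) (m : nat) (T : topologicalType)
    (c1 c2 : chart R m T) :=
  forall i : 'I_m,
    smooth_on (chart_img c1 `&` chart_inv c1 @^-1` chart_dom c2)
      (fun x => chart_map c2 (chart_inv c1 x) 0 i).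

Record manifold (R : realType) (m : nat) := Manifold {
  point_of :> topologicalType;
  atlas : set (chart R m point_of);
  manifold_hausdorff : hausdorff_space point_of;
  manifold_second_countable : @second_countable point_of;
  atlas_cover : forall p, exists2 c, atlas c & chart_dom c p;
  atlas_smooth : forall c1 c2, atlas c1 -> atlas c2 -> smooth_transition c1 c2 }.

Section SmoothFunctions.
Context {R : realType} {m : nat}.
Variable M : manifold R m.

Definition smooth (f : M -> R) :=
  forall c, atlas c -> smooth_on (chart_img c) (f \o chart_inv c).

Definition smooth_pred : {pred M -> R} := fun f => `[< smooth f >].

Lemma smooth_pred_subring : subring_closed smooth_pred.
Proof.
have key c : open (chart_img (c : chart R m M)) by exact: chart_img_open.
have N f : smooth f -> smooth (- f).
  move=> sf c ac k.
  have := CkM (key c) (Ck_cst k (chart_img c) (-1)) (sf c ac k).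
  by apply: Ck_ext (key c) _ => x _; rewrite !fctE /= mulN1r.
split.
- by apply/asboolP => c ac k; exact: Ck_cst.
- move=> f g /asboolP sf /asboolP /N sg; apply/asboolP => c ac k.
  exact: CkD (key c) (sf c ac k) (sg c ac k).
- move=> f g /asboolP sf /asboolP sg; apply/asboolP => c ac k.
  exact: CkM (key c) (sf c ac k) (sg c ac k).
Qed.

HB.instance Definition _ :=
  GRing.isSubringClosed.Build (M -> R) smooth_pred smooth_pred_subring.

Record smoothfun := Smoothfun {
  smoothfun_val :> M -> R;
  smoothfunP : smoothfun_val \in smooth_pred }.

HB.instance Definition _ := [isSub for smoothfun_val].
HB.instance Definition _ := [Choice of smoothfun by <:].
HB.instance Definition _ := GRing.SubChoice_isSubComPzRing.Build
  (M -> R) smooth_pred smoothfun smooth_pred_subring.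

Lemma smooth_cst (k : R) : (fun=> k : R) \in smooth_pred.
Proof. by apply/asboolP => c ac n; exact: Ck_cst. Qed.

Definition cstf (k : R) : smoothfun := Smoothfun (smooth_cst k).

End SmoothFunctions.

Section VectorFields.
Context {R : realType} {m : nat}.
Variable M : manifold R m.
Local Notation C := (smoothfun M).

(* Smooth vector fields, as derivations of the algebra of smooth functions. *)
Record vfield := Vfield {
  vf :> C -> C;
  vfD : forall f g, vf (f + g) = vf f + vf g;
  vfZ : forall (k : R) f, vf (cstf M k * f) = cstf M k * vf f;
  vfM : forall f g, vf (f * g) = vf f * g + f * vf g }.

Implicit Types X Y Z : vfield.

Lemma vfieldP X Y : (forall f, X f = Y f) -> X = Y.
Proof.
case: X Y => [x xD xZ xM] [y yD yZ yM] /= /funext e; subst y.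
by congr Vfield; exact: Prop_irrelevance.
Qed.

Lemma vf0 X : X 0 = 0.
Proof. by apply: (addrI (X 0)); rewrite -vfD !addr0. Qed.

Lemma vfN X f : X (- f) = - X f.
Proof. by apply/eqP; rewrite -addr_eq0 -vfD addNr vf0. Qed.

Lemma vfB X f g : X (f - g) = X f - X g.
Proof. by rewrite vfD vfN. Qed.

Program Definition vzero : vfield := @Vfield (fun=> 0) _ _ _.
Next Obligation. by move=> * /=; rewrite addr0. Qed.
Next Obligation. by move=> * /=; rewrite mulr0. Qed.
Next Obligation. by move=> * /=; rewrite mul0r mulr0 addr0. Qed.

Program Definition vopp X : vfield := @Vfield (fun f => - X f) _ _ _.
Next Obligation. by move=> * /=; rewrite vfD opprD. Qed.
Next Obligation. by move=> * /=; rewrite vfZ mulrN. Qed.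
Next Obligation. by move=> * /=; rewrite vfM opprD mulNr mulrN. Qed.

Program Definition vadd X Y : vfield := @Vfield (fun f => X f + Y f) _ _ _.
Next Obligation. by move=> * /=; rewrite !vfD addrACA. Qed.
Next Obligation. by move=> * /=; rewrite !vfZ mulrDr. Qed.
Next Obligation. by move=> * /=; rewrite !vfM mulrDl mulrDr addrACA. Qed.

Program Definition vscale (h : C) X : vfield := @Vfield (fun f => h * X f) _ _ _.
Next Obligation. by move=> * /=; rewrite vfD mulrDr. Qed.
Next Obligation. by move=> * /=; rewrite vfZ mulrCA. Qed.
Next Obligation. by move=> * /=; rewrite vfM; ring. Qed.

HB.instance Definition _ := gen_eqMixin vfield.
HB.instance Definition _ := gen_choiceMixin vfield.

Fact vaddA : associative vadd.
Proof. by move=> X Y Z; apply: vfieldP => f /=; rewrite addrA. Qed.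
Fact vaddC : commutative vadd.
Proof. by move=> X Y; apply: vfieldP => f /=; rewrite addrC. Qed.
Fact vadd0 : left_id vzero vadd.
Proof. by move=> X; apply: vfieldP => f /=; rewrite add0r. Qed.
Fact vaddN : left_inverse vzero vopp vadd.
Proof. by move=> X; apply: vfieldP => f /=; rewrite addNr. Qed.

HB.instance Definition _ := GRing.isZmodule.Build vfield vaddA vaddC vadd0 vaddN.

Fact vscaleA (h k : C) X : vscale h (vscale k X) = vscale (h * k) X.
Proof. by apply: vfieldP => f /=; rewrite mulrA. Qed.
Fact vscale1 : left_id 1 vscale.
Proof. by move=> X; apply: vfieldP => f /=; rewrite mul1r. Qed.
Fact vscaleDr : right_distributive vscale +%R.
Proof. by move=> h X Y; apply: vfieldP => f /=; rewrite mulrDr. Qed.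
Fact vscaleDl X : {morph vscale^~ X : h k / h + k}.
Proof. by move=> h k; apply: vfieldP => f /=; rewrite mulrDl. Qed.

HB.instance Definition _ := GRing.Zmodule_isLmodule.Build C vfield
  vscaleA vscale1 vscaleDr vscaleDl.

Program Definition lie X Y : vfield :=
  @Vfield (fun f => X (Y f) - Y (X f)) _ _ _.
Next Obligation. by move=> * /=; rewrite !vfD opprD addrACA. Qed.
Next Obligation. by move=> * /=; rewrite !vfZ mulrBr. Qed.
Next Obligation.
by move=> X Y f g /=; rewrite !(vfM, vfD); ring.
Qed.

End VectorFields.
Section Riemannian.
Context {R : realType} {m : nat} {M : manifold R m}.
Local Notation C := (smoothfun M).
Local Notation V := (vfield M).

Record metric := Metric {
  metric_fun :> V -> V -> C;
  metricC : forall X Y : V, metric_fun X Y = metric_fun Y X;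
  metricDl : forall X Y Z : V,
    metric_fun (X + Y) Z = metric_fun X Z + metric_fun Y Z;
  metricZl : forall (f : C) (X Z : V), metric_fun (f *: X) Z = f * metric_fun X Z;
  metric_ge0 : forall (X : V) p, 0 <= metric_fun X X p;
  metric_def : forall (X : V) p, metric_fun X X p = 0 -> forall f, X f p = 0 }.

Record levi_civita (g : metric) (nabla : V -> V -> V) : Prop := LeviCivita {
  nablaDl : forall X Y Z : V, nabla (X + Y) Z = nabla X Z + nabla Y Z;
  nablaZl : forall (f : C) (X Z : V), nabla (f *: X) Z = f *: nabla X Z;
  nablaDr : forall X Y Z : V, nabla X (Y + Z) = nabla X Y + nabla X Z;
  nabla_leibniz : forall (X : V) (f : C) (Y : V),
    nabla X (f *: Y) = X f *: Y + f *: nabla X Y;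
  nabla_torsion_free : forall X Y : V, nabla X Y - nabla Y X = lie X Y;
  nabla_metric : forall X Y Z : V, X (g Y Z) = g (nabla X Y) Z + g Y (nabla X Z) }.

Definition curvature (nabla : V -> V -> V) (X Y Z : V) : V :=
  nabla X (nabla Y Z) - nabla Y (nabla X Z) - nabla (lie X Y) Z.

(* The values at p of the vector fields E_0, ..., E_(m-1) form a basis of the
   tangent space at p.  A tangent vector at p is identified with its action on
   smooth functions; each one is the value at p of a global vector field. *)
Definition frame_at (p : M) (E : 'I_m -> V) :=
  forall X : V, exists! c : 'rV[R]_m, forall f, X f p = \sum_i c 0 i * E i f p.

(* t is the trace of the endomorphism of the tangent space at p induced by A,
   computed in some basis (for the tensorial A used below, every basis gives
   the same value). *)
Definition trace_at (p : M) (A : V -> V) (t : R) :=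
  exists (E : 'I_m -> V) (a : 'M[R]_m),
    [/\ frame_at p E,
        forall i f, A (E i) f p = \sum_j a i j * E j f p &
        t = \tr a].

Definition is_ricci (nabla : V -> V -> V) (S : V -> V -> C) :=
  forall (X Y : V) p, trace_at p (fun Z => curvature nabla Z X Y) (S X Y p).

Definition is_ricci_operator (g : metric) (S : V -> V -> C) (Q : V -> V) :=
  forall X Y : V, S X Y = g (Q X) Y.

Definition is_scalar_curvature (Q : V -> V) (r : C) :=
  forall p, trace_at p Q (r p).

(* The exterior derivative is normalized with the factor 1/2 usual in contact
   metric geometry; with it the unit odd-dimensional spheres are contact metric
   manifolds. *)
Definition dform (eta : V -> C) (X Y : V) : C :=
  cstf M 2^-1 * (X (eta Y) - Y (eta X) - eta (lie X Y)).

Record contact_metric (phi : {linear V -> V}) (xi : V)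
    (eta : {linear V -> C^o}) (g : metric) : Prop := ContactMetric {
  contact_phi2 : forall X : V, phi (phi X) = - X + (eta X : C) *: xi;
  contact_eta_xi : eta xi = 1;
  contact_phi_xi : phi xi = 0;
  contact_eta_phi : forall X : V, eta (phi X) = 0;
  contact_g_phi : forall X Y : V, g (phi X) (phi Y) = g X Y - (eta X : C) * eta Y;
  contact_deta : forall X Y : V, dform eta X Y = g X (phi Y) }.

Definition kappa_nullity (nabla : V -> V -> V) (xi : V) (eta : V -> C)
    (kappa : R) :=
  forall X Y : V, curvature nabla X Y xi = cstf M kappa *: (eta Y *: X - eta X *: Y).

Definition ricci_form_is (g : metric) (eta : V -> C) (S : V -> V -> C)
    (b1 b2 : C) :=
  forall X Y : V, S X Y = b1 * g X Y + b2 * (eta X * eta Y).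

Definition eta_einstein (g : metric) (eta : V -> C) (S : V -> V -> C) :=
  exists b1 b2 : C, ricci_form_is g eta S b1 b2.

Definition einstein (g : metric) (eta : V -> C) (S : V -> V -> C) :=
  exists b1 : C, ricci_form_is g eta S b1 0.

Record coefs := Coefs { a0 : C; a1 : C; a2 : C; a3 : C;
                        a4 : C; a5 : C; a6 : C; a7 : C }.

Definition Tcurv (a : coefs) (g : metric) (nabla : V -> V -> V)
    (S : V -> V -> C) (Q : V -> V) (r : C) (X1 X2 X3 : V) : V :=
  a0 a *: curvature nabla X1 X2 X3
  + (a1 a * S X2 X3) *: X1 + (a2 a * S X1 X3) *: X2 + (a3 a * S X1 X2) *: X3
  + (a4 a * g X2 X3) *: Q X1 + (a5 a * g X1 X3) *: Q X2
  + (a6 a * g X1 X2) *: Q X3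
  + (a7 a * r) *: (g X2 X3 *: X1 - g X1 X3 *: X2).

Definition derivation_action (T : V -> V) (Rm : V -> V -> V -> V)
    (X3 X4 X5 : V) : V :=
  T (Rm X3 X4 X5) - Rm (T X3) X4 X5 - Rm X3 (T X4) X5 - Rm X3 X4 (T X5).

(* T(xi, X1) . R = 0 for all X1 *)
Definition T_xi_semisymmetric (a : coefs) (g : metric) (nabla : V -> V -> V)
    (S : V -> V -> C) (Q : V -> V) (r : C) (xi : V) :=
  forall X1 X3 X4 X5,
    derivation_action (Tcurv a g nabla S Q r xi X1) (curvature nabla) X3 X4 X5
    = 0.

Definition ricC (a : coefs) : C := a1 a + a5 a.

Definition ricA (n : nat) (kappa : R) (a : coefs) : C :=
  - cstf M (2 * n%:R * kappa) * (a2 a + a4 a).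

Definition ricB (n : nat) (kappa : R) (a : coefs) : C :=
  cstf M (2 * n%:R * kappa) * (a1 a + a2 a + a4 a + a5 a).

End Riemannian.

Arguments metric {R m} M.
Arguments coefs {R m} M.

Section SpecialTensors.
Context {R : realType} {m : nat}.
Variables (M : manifold R m) (n : nat).
Local Notation C := (smoothfun M).
Local Notation c := (cstf M (2 * n%:R)^-1).

Definition Pstar (b0 b1 : C) : coefs M :=
  Coefs b0 b1 (- b1) 0 0 0 0 (- cstf M (2 * n%:R + 1)^-1 * (c * b0 + b1)).
Definition W1 : coefs M := Coefs 1 c (- c) 0 0 0 0 0.
Definition W1star : coefs M := Coefs 1 (- c) c 0 0 0 0 0.
Definition W2 : coefs M := Coefs 1 0 0 0 (- c) c 0 0.
Definition W4 : coefs M := Coefs 1 0 0 0 0 c (- c) 0.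
Definition W5 : coefs M := Coefs 1 0 (- c) 0 0 c 0 0.
Definition W6 : coefs M := Coefs 1 (- c) 0 0 0 0 c 0.
Definition W7 : coefs M := Coefs 1 (- c) 0 0 c 0 0 0.
Definition W8 : coefs M := Coefs 1 (- c) 0 c 0 0 0 0.

End SpecialTensors.

(* Main.v *)
Require Import Defs.
From HB Require Import structures.
From mathcomp Require Import all_boot all_order all_algebra.
From mathcomp Require Import all_classical all_reals all_analysis.
From mathcomp Require Import ring lra.

Set Implicit Arguments.
Unset Strict Implicit.
Unset Printing Implicit Defensive.

Import Order.TTheory GRing.Theory Num.Theory.
Import numFieldNormedType.Exports.

Local Open Scope classical_set_scope.
Local Open Scope ring_scope.

(** Write N = 2 n kappa, L X = T(xi, X) and C = a_1 + a_5.  Everything follows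
    from the single identity
      C S(X, Z) = - N (a_2 + a_4) g(X, Z)
                  + N (C + a_2 + a_4) eta(X) eta(Z),
    [ricci_identity]: a nowhere vanishing C has a smooth inverse, and each
    special tensor is a substitution of coefficients.

    The nullity condition gives R(X, Y) xi, hence R(xi, X) Y by the pair symmetry
    of the curvature tensor, and tracing these two expressions gives
    S(X, xi) = S(xi, X) = N eta(X) and Q xi = N xi.  Therefore the xi-component
    of L X Y and the vector L X xi are explicit in terms of g, S and eta.

    When kappa <> 0, the xi-component of (L X . R)(xi, Z) xi = 0 reduces to kappa
    times the identity, because R(_, _) xi has no xi-component
    ([nullity_times_ricci]).

    When kappa = 0 this says nothing, but then xi annihilates the curvature in
    every slot, and the identity to be proved is S = 0.  The xi-component of
    (L X . R)(Y, Z) W = 0 and the equation (L X . R)(Y, Z) xi = 0 read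
      a_7 r R(Y, Z) X + a_1 R(Y, Z) Q X = 0,
      - a_7 r R(Y, Z) X + a_5 R(Y, Z) Q X = 0,
    so that R(Y, Z) (C Q X) = 0 ([curvature_ricci_op_eq0]).  Tracing over Y gives
    C g(Q X, Q X) = 0, and Q = 0 since g is positive definite ([ricci_eq0]).

    The delicate point is the computation of the traces.  The Ricci tensor
    is a trace in a frame of one tangent space, whereas the trace of
    Z |-> eta(Z) X involves the values eta(E_i) of global vector fields; one has
    to know that a functional which is linear over smooth functions vanishes at p
    on a field that vanishes at p.  Instead of bump functions,
    [tensorial_vanish] uses Jacobian determinants and the existence of a frame at
    every point, which the Ricci tensor provides. *)

(** * Tensoriality and traces *)

Section Pointwise.
Context {R : realType} {m : nat} {M : manifold R m}.
Local Notation C := (smoothfun M).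
Local Notation V := (vfield M).

Lemma smoothfunE (f g : C) : (forall p, f p = g p) -> f = g.
Proof. by move=> fg; apply/val_inj/funext. Qed.

(** A ring morphism, so that determinants can be evaluated at a point. *)
Definition eval_at (p : M) (f : C) : R := f p.

Fact eval_at_zmod p : zmod_morphism (eval_at p).
Proof. by []. Qed.
Fact eval_at_monoid p : monoid_morphism (eval_at p).
Proof. by []. Qed.
HB.instance Definition _ p :=
  GRing.isZmodMorphism.Build C R (eval_at p) (eval_at_zmod p).
HB.instance Definition _ p :=
  GRing.isMonoidMorphism.Build C R (eval_at p) (eval_at_monoid p).

Lemma smooth_subE (f g : C) p : (f - g) p = f p - g p. Proof. by []. Qed.
Lemma smooth_sumE k (F : 'I_k -> C) p : (\sum_i F i) p = \sum_i F i p.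
Proof. exact: (raddf_sum (eval_at p)). Qed.

Lemma vf_addE (X Y : V) f : (X + Y) f = X f + Y f. Proof. by []. Qed.
Lemma vf_oppE (X : V) f : (- X) f = - X f. Proof. by []. Qed.
Lemma vf_scaleE (h : C) (X : V) f : (h *: X) f = h * X f. Proof. by []. Qed.

Lemma vf_sumE k (F : 'I_k -> V) f : (\sum_i F i) f = \sum_i F i f.
Proof.
by elim/big_rec2: _ => // i x Y _ <-; rewrite vf_addE.
Qed.

Lemma cofactor_zero_row (A : comPzRingType) k (B : 'M[A]_k) i0 i j0 :
  i != i0 -> (forall j, B i0 j = 0) -> cofactor B i j0 = 0.
Proof.
move=> /unlift_some[a i0E _] B0; rewrite /cofactor (expand_det_row _ a).
by rewrite big1 ?mulr0 // => j _; rewrite !mxE -i0E B0 mul0r.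
Qed.

Definition jacobian k (F : 'I_k -> V) (h : 'I_k -> C) : 'M[C]_k :=
  \matrix_(i, j) F i (h j).

(** The cofactors along the first column ignore the first function, so that the
    determinant is the value of one fixed vector field on that function. *)
Lemma cofactor_jacobian k (F : 'I_k.+1 -> V) (h h' : 'I_k.+1 -> C) i :
  (forall j, h (lift ord0 j) = h' (lift ord0 j)) ->
  cofactor (jacobian F h) i ord0 = cofactor (jacobian F h') i ord0.
Proof.
by move=> hh; congr (_ * \det _); apply/matrixP => a b; rewrite !mxE hh.
Qed.

Definition cons_fun k (f : C) (h : 'I_k -> C) (i : 'I_k.+1) : C :=
  if unlift ord0 i is Some j then h j else f.

Definition cons_vf k (Y : V) (E : 'I_k -> V) (i : 'I_k.+1) : V :=
  if unlift ord0 i is Some j then E j else Y.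

(** Laplace expansion along the column of [f]: as [f] varies, the determinant is
    a derivation, a combination of the rows with cofactors as coefficients. *)
Lemma det_jacobian_cons k (F : 'I_k.+1 -> V) (h : 'I_k -> C) f :
  \det (jacobian F (cons_fun f h)) =
  (\sum_i cofactor (jacobian F (cons_fun 0 h)) i ord0 *: F i) f.
Proof.
rewrite (expand_det_col _ ord0) [RHS]vf_sumE; apply: eq_bigr => i _.
have cofE : cofactor (jacobian F (cons_fun f h)) i ord0 =
    cofactor (jacobian F (cons_fun 0 h)) i ord0.
  by apply: cofactor_jacobian => j; rewrite /cons_fun liftK.
by rewrite [RHS]vf_scaleE -cofE mxE {1}/cons_fun unlift_none mulrC.
Qed.

Definition independent_at p k (E : 'I_k -> V) :=
  forall c : 'I_k -> R, (forall f, \sum_i c i * E i f p = 0) ->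
  forall i, c i = 0.

Lemma frame_independent p (E : 'I_m -> V) : frame_at p E -> independent_at p E.
Proof.
move=> /(_ 0) [c0 [_ c0_uniq]] c cE i.
have e1 : c0 = \row_i c i.
  by apply: c0_uniq => f; under eq_bigr do rewrite mxE; rewrite cE.
have e2 : c0 = 0.
  by apply: c0_uniq => f; rewrite big1 // => j _; rewrite mxE mul0r.
by move/rowP/(_ i): e1; rewrite e2 !mxE.
Qed.

(** Induction on [k]: if no function could be added in front of those chosen for
    the last fields, expanding along its column would give a linear relation at
    [p] in which the first field has a nonzero coefficient. *)
Lemma local_coordinates p k (E : 'I_k -> V) : independent_at p E ->
  exists h : 'I_k -> C, \det (jacobian E h) p != 0.
Proof.
elim: k E => [|k IH] E indE.
  by exists (fun=> 0); rewrite det_mx00; exact: oner_neq0.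
have [|h hn0] := IH (E \o lift ord0).
  move=> c cE j.
  pose c' i := if unlift ord0 i is Some j then c j else 0.
  have := indE c' _ (lift ord0 j).
  rewrite /c' liftK; apply=> f.
  rewrite big_ord_recl unlift_none mul0r add0r -[RHS](cE f).
  by apply: eq_bigr => i _; rewrite liftK.
apply: contrapT => noh.
pose cof i := cofactor (jacobian E (cons_fun 0 h)) i ord0.
have /(_ ord0) : forall i, cof i p = 0.
  apply: indE => f; have : \det (jacobian E (cons_fun f h)) p = 0.
    by apply/eqP/negPn/negP => d0; apply: noh; exists (cons_fun f h).
  by rewrite det_jacobian_cons vf_sumE smooth_sumE.
rewrite /cof /cofactor addn0 expr0 mul1r => d0; move/eqP: hn0; apply.
rewrite -[RHS]d0; congr (smoothfun_val (\det _) p).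
by apply/matrixP => i j; rewrite !mxE /cons_fun liftK.
Qed.

Hypothesis frames : forall q : M, exists E : 'I_m -> V, frame_at q E.

(** One more vector than the dimension of the tangent space: at each point the
    Jacobian matrix factors through the coordinates in a frame. *)
Lemma det_jacobian_overfull (F : 'I_m.+1 -> V) h : \det (jacobian F h) = 0.
Proof.
apply: smoothfunE => q; have [G frG] := frames q.
have /fin_all_exists [B BE] i : exists b : 'rV[R]_m,
    forall f, F i f q = \sum_j b 0 j * G j f q.
  by have [b [bE _]] := frG (F i); exists b.
pose B' := \matrix_i B i; pose G' := \matrix_(i, j) G i (h j) q.
have e : map_mx (eval_at q) (jacobian F h) = B' *m G'.
  apply/matrixP => i j; rewrite !mxE [LHS]BE.
  by apply: eq_bigr => k _; rewrite !mxE.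
rewrite -[LHS]/(eval_at q _) -det_map_mx e.
apply/eqP; rewrite -[_ == _]negbK -unitfE -unitmxE -row_free_unit.
rewrite /row_free; apply/eqP => r1.
by have := leq_trans (mxrankM_maxl B' G') (rank_leq_col B'); rewrite r1 ltnn.
Qed.

(** Adjoin [Y] to a frame [E] at [p] with local coordinates [h].  The Jacobian
    of these [m + 1] fields vanishes identically, whatever function is added to
    [h], so the cofactors give a global relation [D *: Y + \sum_i c_i *: E_i = 0]
    with [D p != 0].  Each [c_i] keeps the row of [Y] and so vanishes at [p];
    applying [l] gives [D p * l Y p = 0]. *)
Lemma tensorial_vanish (l : V -> C) (Y : V) p :
  (forall X Z : V, l (X + Z) = l X + l Z) ->
  (forall (f : C) (X : V), l (f *: X) = f * l X) ->
  (forall f, Y f p = 0) -> l Y p = 0.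
Proof.
move=> lD lZ Y0; have [E frE] := frames p.
have [h hn0] := local_coordinates (frame_independent frE).
pose cof i := cofactor (jacobian (cons_vf Y E) (cons_fun 0 h)) i ord0.
have W0 : \sum_i cof i *: cons_vf Y E i = 0.
  by apply: vfieldP => f; rewrite -det_jacobian_cons det_jacobian_overfull.
have l0 : l 0 = 0 by rewrite -(scale0r 0) lZ mul0r.
have : \sum_i cof i * l (cons_vf Y E i) = 0.
  rewrite -[RHS]l0 -W0 (big_morph l lD l0).
  by apply: eq_bigr => i _; rewrite lZ.
move/(congr1 (eval_at p)); rewrite rmorph0 rmorph_sum big_ord_recl.
have cof0 i : eval_at p (cof (lift ord0 i)) = 0.
  rewrite /cof -cofactor_map_mx; apply: (@cofactor_zero_row _ _ _ ord0) => // j.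
  by rewrite !mxE /cons_vf unlift_none [LHS]Y0.
rewrite [X in _ + X]big1 ?addr0 => [|i _]; last first.
  by rewrite [LHS]rmorphM [X in X * _]cof0 mul0r.
rewrite [X in X = _]rmorphM => /eqP; rewrite mulf_eq0 /cons_vf unlift_none.
move=> /orP[|/eqP//]; rewrite /cof /cofactor addn0 expr0 mul1r => d0.
case/negP: hn0.
move: d0; congr (smoothfun_val (\det _) p == 0).
by apply/matrixP => i j; rewrite !mxE /cons_fun /cons_vf !liftK.
Qed.

(** The trace of [a * id + l (_) X], read off in any frame; [l X p] is expressed
    in the frame by tensoriality of [l]. *)
Lemma trace_affine p (A : V -> V) (a t : R) (l : V -> C) (X : V) :
  trace_at p A t ->
  (forall X Z : V, l (X + Z) = l X + l Z) ->
  (forall (f : C) (X : V), l (f *: X) = f * l X) ->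
  (forall Z f, A Z f p = a * Z f p + l Z p * X f p) ->
  t = a * m%:R + l X p.
Proof.
move=> [E [b [frE bE ->]]] lD lZ AE.
have [x [xE _]] := frE X.
have l0 : l 0 = 0 by rewrite -(scale0r 0) lZ mul0r.
have lX : l X p = \sum_i x 0 i * l (E i) p.
  have : l (X - \sum_i cstf M (x 0 i) *: E i) p = 0.
    apply: tensorial_vanish => // f; rewrite [X in smoothfun_val X p]vf_addE.
    rewrite [X in smoothfun_val (_ + X) p]vf_oppE vf_sumE smooth_subE.
    by rewrite smooth_sumE xE subrr.
  rewrite lD -scaleN1r lZ mulN1r (big_morph l lD l0).
  rewrite smooth_subE smooth_sumE => /eqP; rewrite subr_eq0 => /eqP ->.
  by apply: eq_bigr => i _; rewrite lZ.
have bE' i j : b i j = a * (i == j)%:R + l (E i) p * x 0 j.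
  apply/eqP; rewrite -subr_eq0; apply/eqP.
  pose c j := b i j - (a * (i == j)%:R + l (E i) p * x 0 j).
  apply: (frame_independent frE (c := c)).
  move=> f; under eq_bigr do rewrite /c mulrBl mulrDl.
  rewrite sumrB big_split /= -bE AE xE mulr_sumr.
  under [X in _ - (_ + X)]eq_bigr do rewrite -mulrA.
  rewrite [X in _ - (X + _)](bigD1 i) //= eqxx mulr1.
  rewrite [X in _ - (_ + X + _)]big1 ?addr0 ?subrr // => k.
  by rewrite eq_sym => /negPf ->; rewrite mulr0 mul0r.
rewrite /mxtrace; under eq_bigr do rewrite bE' eqxx mulr1 [_ * x 0 _]mulrC.
by rewrite big_split /= sumr_const card_ord lX [in RHS]mulr_natr.
Qed.

End Pointwise.

(** * Symmetries of the curvature tensor *)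

Section Curvature.
Context {R : realType} {m : nat} {M : manifold R m}.
Local Notation C := (smoothfun M).
Local Notation V := (vfield M).
Variables (g : metric M) (nabla : V -> V -> V).
Hypothesis hLC : levi_civita g nabla.
Implicit Types X Y Z W : V.
Local Notation Rm := (curvature nabla).

Lemma metricDr X Y Z : g X (Y + Z) = g X Y + g X Z.
Proof. by rewrite metricC metricDl !(metricC _ X). Qed.
Lemma metricZr f X Y : g X (f *: Y) = f * g X Y.
Proof. by rewrite metricC metricZl metricC. Qed.
Lemma metricNl X Y : g (- X) Y = - g X Y.
Proof. by rewrite -scaleN1r metricZl mulN1r. Qed.
Lemma metricNr X Y : g X (- Y) = - g X Y.
Proof. by rewrite metricC metricNl metricC. Qed.
Lemma metric0l X : g 0 X = 0.
Proof. by rewrite -(scale0r 0) metricZl mul0r. Qed.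

Lemma metric_self_eq0 X : g X X = 0 -> X = 0.
Proof.
move=> gX; apply: vfieldP => f; apply: smoothfunE => p.
by apply: (@metric_def _ _ _ g); rewrite gX.
Qed.

Lemma metric_inj X Y : (forall W, g X W = g Y W) -> X = Y.
Proof.
move=> XY; apply/eqP; rewrite -subr_eq0; apply/eqP/metric_self_eq0.
by rewrite metricDl metricNl XY subrr.
Qed.

Lemma nablaNl X Y : nabla (- X) Y = - nabla X Y.
Proof. by rewrite -scaleN1r (nablaZl hLC) scaleN1r. Qed.
Lemma nablaNr X Y : nabla X (- Y) = - nabla X Y.
Proof.
by apply: (addrI (nabla X Y)); rewrite -(nablaDr hLC) !subrr;
  apply: (addrI (nabla X 0)); rewrite -(nablaDr hLC) !addr0.
Qed.

Lemma lieC X Y : lie X Y = - lie Y X.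
Proof. by apply: vfieldP => f; rewrite vf_oppE /= opprB. Qed.
Lemma lieDl X Y Z : lie (X + Y) Z = lie X Z + lie Y Z.
Proof. by apply: vfieldP => f; rewrite /= vfD; ring. Qed.
Lemma lieZl f X Y : lie (f *: X) Y = f *: lie X Y - Y f *: X.
Proof. by apply: vfieldP => h; rewrite /= vfM; ring. Qed.

Lemma curvatureC X Y Z : Rm X Y Z = - Rm Y X Z.
Proof.
rewrite /curvature lieC nablaNl.
by apply: vfieldP => f; rewrite /=; ring.
Qed.

Lemma curvatureDl X X' Y Z : Rm (X + X') Y Z = Rm X Y Z + Rm X' Y Z.
Proof.
rewrite /curvature lieDl !(nablaDl hLC) (nablaDr hLC).
by apply: vfieldP => f; rewrite /=; ring.
Qed.

Lemma curvatureZl f X Y Z : Rm (f *: X) Y Z = f *: Rm X Y Z.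
Proof.
rewrite /curvature lieZl (nablaDl hLC) nablaNl !(nablaZl hLC) (nabla_leibniz hLC).
by apply: vfieldP => h; rewrite /=; ring.
Qed.

(** Without torsion the [nabla] terms cancel in pairs and the Jacobi identity is
    left. *)
Lemma bianchi X Y Z : Rm X Y Z + Rm Y Z X + Rm Z X Y = 0.
Proof.
have e A B D : Rm A B D = nabla A (nabla B D) - nabla B (nabla A D)
    - (nabla D (nabla A B) - nabla D (nabla B A)) - lie (lie A B) D.
  rewrite -(nabla_torsion_free hLC (lie A B)) -[- nabla D (nabla B A)]nablaNr.
  rewrite -[nabla D _ + nabla D _](nablaDr hLC) (nabla_torsion_free hLC).
  by rewrite /curvature; apply: vfieldP => f; rewrite /=; ring.
rewrite !e; apply: vfieldP => f; rewrite /= !(vfD, vfN); ring.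
Qed.

(** The Lie bracket acts on the function [g Z W] as a commutator; expand it with
    metric compatibility. *)
Lemma curvature_skew X Y Z W : g (Rm X Y Z) W = - g (Rm X Y W) Z.
Proof.
have e : X (Y (g Z W)) - Y (X (g Z W)) - lie X Y (g Z W) = 0 by rewrite /= subrr.
rewrite !(nabla_metric hLC) !vfD !(nabla_metric hLC) in e.
rewrite (metricC g (Rm X Y W)) /curvature !metricDl !metricNl !metricDr !metricNr.
by apply/eqP; rewrite -subr_eq0 -[X in _ == X]e; apply/eqP; ring.
Qed.
Lemma curvature_pair X Y Z W : g (Rm X Y Z) W = g (Rm Z W X) Y.
Proof.
apply: smoothfunE => p; pose K A B D E := g (Rm A B D) E p.
have Ka A B D E : K A B D E = - K B A D E.
  by rewrite /K curvatureC metricNl.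
have Ks A B D E : K A B D E = - K A B E D.
  by rewrite /K curvature_skew.
have Kb A B D E : K A B D E + K B D A E + K D A B E = 0.
  have : g (Rm A B D + Rm B D A + Rm D A B) E = 0 by rewrite bianchi metric0l.
  by rewrite 2!metricDl => /(congr1 (fun f : C => f p)).
(* b(X,Y,Z;W) + b(Y,Z,W;X) - b(Z,W,X;Y) - b(W,X,Y;Z) for the Bianchi sums b *)
have := Kb X Y Z W; have := Kb Y Z W X; have := Kb Z W X Y; have := Kb W X Y Z.
have := Ks Y Z X W; have := Ks Z W X Y; have := Ks W X Y Z; have := Ks X Y Z W.
have := Ka X Z W Y; have := Ks Z X W Y; have := Ka Y W X Z; have := Ks W Y X Z.
rewrite -/(K X Y Z W) -/(K Z W X Y) => *; lra.
Qed.

(** Linearity in the last slot is inherited from the first through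
    [curvature_pair]. *)
Lemma curvatureDr X Y Z Z' : Rm X Y (Z + Z') = Rm X Y Z + Rm X Y Z'.
Proof.
apply: metric_inj => W.
by rewrite metricDl !(curvature_pair X Y) curvatureDl metricDl.
Qed.

Lemma curvatureZr f X Y Z : Rm X Y (f *: Z) = f *: Rm X Y Z.
Proof.
apply: metric_inj => W.
by rewrite metricZl !(curvature_pair X Y) curvatureZl metricZl.
Qed.

End Curvature.

(** * Contact metric manifolds with a nullity condition *)

Section NullityContact.
Context {R : realType} {n : nat} {M : manifold R (2 * n + 1)%N}.
Local Notation C := (smoothfun M).
Local Notation V := (vfield M).
Variables (g : metric M) (nabla : V -> V -> V) (phi : {linear V -> V}) (xi : V).
Variables (eta : {linear V -> C^o}) (kappa : R).
Variables (S : V -> V -> C) (Q : V -> V) (r : C).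
Hypothesis hLC : levi_civita g nabla.
Hypothesis hcontact : contact_metric phi xi eta g.
Hypothesis hkappa : kappa_nullity nabla xi eta kappa.
Hypothesis hS : is_ricci nabla S.
Hypothesis hQ : is_ricci_operator g S Q.
Local Notation Rm := (curvature nabla).
Local Notation k := (cstf M kappa).
Local Notation N := (cstf M (2 * n%:R * kappa)).
Implicit Types X Y Z W : V.

Lemma eta_metric X : eta X = g X xi.
Proof.
have := contact_g_phi hcontact X xi.
rewrite (contact_phi_xi hcontact) metricC metric0l (contact_eta_xi hcontact) mulr1.
by move/eqP; rewrite eq_sym subr_eq0 => /eqP.
Qed.

Lemma metric_xi_xi : g xi xi = 1.
Proof. by rewrite -eta_metric (contact_eta_xi hcontact). Qed.

Lemma curvature_to_xi X Y : Rm X Y xi = k *: (g Y xi *: X - g X xi *: Y).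
Proof. by rewrite hkappa !eta_metric. Qed.

Lemma curvature_from_xi X Y : Rm xi X Y = k *: (g X Y *: xi - g Y xi *: X).
Proof.
apply: (metric_inj (g := g)) => W; rewrite (curvature_pair hLC) curvature_to_xi.
rewrite !(metricZl, metricDl, metricNl) (metricC g W X) (metricC g W xi).
by rewrite (metricC g Y X); ring.
Qed.

Lemma ricci_frames (q : M) : exists E : 'I_(2 * n + 1) -> V, frame_at q E.
Proof. by have [E [_ [frE _ _]]] := hS 0 0 q; exists E. Qed.

(** The trace of [Z |-> kappa (eta(X) Z - eta(Z) X)] in dimension [2 n + 1] is
    [kappa ((2 n + 1) - 1) eta(X)]. *)
Lemma ricci_to_xi X : S X xi = N * g X xi.
Proof.
apply: smoothfunE => p.
have := trace_affine ricci_frames (hS X xi p)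
  (a := kappa * g X xi p) (l := fun Z => - k * g Z xi) (X := X).
move=> ->.
- have -> : forall f : C, (- k * f) p = - kappa * f p by [].
  have -> : forall f : C, (N * f) p = 2 * n%:R * kappa * f p by [].
  by rewrite natrD natrM; ring.
- by move=> Y Z; rewrite metricDl mulrDr.
- by move=> f Y; rewrite metricZl mulrCA.
- move=> Z f; rewrite curvature_to_xi.
  have -> : (k *: (g X xi *: Z - g Z xi *: X)) f p =
    kappa * (g X xi p * Z f p - g Z xi p * X f p) by [].
  have -> : (- k * g Z xi) p = - kappa * g Z xi p by [].
  ring.
Qed.

(** Computed from [curvature_from_xi], which replaces an appeal to the symmetry
    of the Ricci tensor. *)
Lemma ricci_from_xi X : S xi X = N * g X xi.
Proof.
apply: smoothfunE => p.
have := trace_affine ricci_frames (hS xi X p)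
  (a := kappa * g X xi p) (l := fun Z => - k * g Z X) (X := xi).
move=> ->.
- have -> : forall f : C, (- k * f) p = - kappa * f p by [].
  have -> : forall f : C, (N * f) p = 2 * n%:R * kappa * f p by [].
  by rewrite (metricC g xi X) natrD natrM; ring.
- by move=> Y Z; rewrite metricDl mulrDr.
- by move=> f Y; rewrite metricZl mulrCA.
- move=> Z f; rewrite (curvatureC hLC) curvature_from_xi.
  have -> : (- (k *: (g Z X *: xi - g X xi *: Z))) f p =
    - (kappa * (g Z X p * xi f p - g X xi p * Z f p)) by [].
  have -> : (- k * g Z X) p = - kappa * g Z X p by [].
  ring.
Qed.

Lemma ricci_op_xi : Q xi = N *: xi.
Proof.
apply: (metric_inj (g := g)) => W.
by rewrite -hQ ricci_from_xi metricZl (metricC g W).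
Qed.

Variable a : coefs M.
Hypothesis semisym : T_xi_semisymmetric a g nabla S Q r xi.
Local Notation L := (Tcurv a g nabla S Q r xi).

Lemma Tcurv_xi_normal X Y : g (L X Y) xi =
  a0 a * (k * (g X Y - g X xi * g Y xi)) + a1 a * S X Y
  + (a2 a + a3 a + a5 a + a6 a) * (N * (g X xi * g Y xi))
  + a4 a * (N * g X Y) + a7 a * r * (g X Y - g X xi * g Y xi).
Proof.
rewrite /Tcurv curvature_from_xi !(metricDl, metricZl, metricNl).
rewrite -!hQ !ricci_to_xi !ricci_from_xi metric_xi_xi.
by rewrite !(metricC g xi); ring.
Qed.

Lemma Tcurv_xi_xi X W : g (L X xi) W =
  a0 a * (k * (g X xi * g W xi - g X W))
  + (a1 a + a3 a + a4 a + a6 a) * (N * (g X xi * g W xi))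
  + a2 a * (N * g X W) + a5 a * S X W + a7 a * r * (g X xi * g W xi - g X W).
Proof.
rewrite /Tcurv curvature_from_xi !(metricDl, metricZl, metricNl).
rewrite -!hQ !ricci_to_xi !ricci_from_xi metric_xi_xi.
by rewrite !(metricC g xi); ring.
Qed.

(** This is [eta ((T(xi, X) . R)(xi, Z) xi) = 0].  The two middle terms of the
    derivation drop out since [R(_, _) xi] is orthogonal to [xi]; in the other
    two the coefficients [a0], [a3], [a6] and [a7] cancel. *)
Lemma nullity_times_ricci X Z :
  k * (ricC a * S X Z) =
  k * (ricA n kappa a * g X Z + ricB n kappa a * (g X xi * g Z xi)).
Proof.
have := congr1 (fun U => g U xi) (semisym X xi Z xi).
rewrite /derivation_action metric0l.
have curv0 U W : g (Rm U W xi) xi = 0.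
  by rewrite curvature_to_xi metricZl metricDl metricNl !metricZl; ring.
rewrite [g (_ - Rm xi Z _) xi]metricDl metricNl.
rewrite [g (_ - Rm xi _ xi) xi]metricDl metricNl curv0 subr0.
rewrite [g (_ - Rm _ Z xi) xi]metricDl metricNl curv0 subr0.
rewrite (curvature_from_xi Z (L X xi)) [g (k *: _) xi]metricZl.
rewrite [g (g Z _ *: _ - _) xi]metricDl metricNl.
rewrite [g (g Z _ *: _) xi]metricZl [g (g _ xi *: Z) xi]metricZl.
rewrite metric_xi_xi mulr1 (metricC g Z) Tcurv_xi_xi Tcurv_xi_xi.
rewrite Tcurv_xi_normal curvature_to_xi metric_xi_xi.
rewrite !hQ !(metricZr, metricDr, metricNr) -!hQ !(metricZl, metricDl, metricNl).
rewrite !ricci_to_xi metric_xi_xi (metricC g Z xi) (metricC g xi Z).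
rewrite /ricC /ricA /ricB => e.
by apply/eqP; rewrite -subr_eq0 -oppr_eq0 -e; apply/eqP; ring.
Qed.

(** For [kappa = 0] the curvature vanishes as soon as one slot is [xi].  The
    [xi]-component of the hypothesis at [(Y, Z, W)] brings in [a1], its value at
    [(Y, Z, xi)] brings in [a5]; adding the two removes [a7 * r]. *)
Lemma curvature_ricci_op_eq0 X Y Z : kappa = 0 ->
  Rm Y Z (ricC a *: Q X) = 0.
Proof.
move=> kappa0; have k0 : k = 0 by apply: smoothfunE => p; rewrite /= kappa0.
have N0 : N = 0 by apply: smoothfunE => p; rewrite /= kappa0 mulr0.
have to0 U W : Rm U W xi = 0 by rewrite curvature_to_xi k0 scale0r.
have from0 U W : Rm xi U W = 0 by rewrite curvature_from_xi k0 scale0r.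
have e1 : a7 a * r *: Rm Y Z X + a1 a *: Rm Y Z (Q X) = 0.
  apply: (metric_inj (g := g)) => W.
  have := congr1 (fun U => g U xi) (semisym X Y Z W).
  have curv0 A B D : g (Rm A B D) xi = 0.
    by rewrite (curvature_skew hLC) to0 metric0l oppr0.
  rewrite /derivation_action metric0l.
  do 3 rewrite [g (_ - Rm _ _ _) xi]metricDl metricNl curv0 subr0.
  rewrite Tcurv_xi_normal curv0 hQ k0 N0 => e.
  rewrite metric0l metricDl !metricZl.
  rewrite (curvature_skew hLC _ _ X) (curvature_skew hLC _ _ (Q X)).
  by rewrite -[RHS]oppr0 -e (metricC g X) (metricC g (Q X)); ring.
(* [Q] is known only through [S], hence through a trace *)
have Q0 : Q 0 = 0.
  apply: (metric_inj (g := g)) => W; rewrite -hQ metric0l; apply: smoothfunE => p.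
  have -> := trace_affine ricci_frames (hS 0 W p) (a := 0) (l := fun=> 0) (X := 0).
  - by rewrite mul0r addr0.
  - by move=> *; rewrite addr0.
  - by move=> *; rewrite mulr0.
  - move=> A f; rewrite (curvatureC hLC) -(scale0r 0) (curvatureZl hLC) scale0r oppr0.
    by rewrite !mul0r addr0.
have e2 : - (a7 a * r *: Rm Y Z X) + a5 a *: Rm Y Z (Q X) = 0.
  have := semisym X Y Z xi; rewrite /derivation_action !to0 !subr0.
  have -> : L X 0 = 0.
    rewrite /Tcurv from0 Q0 !hQ ricci_op_xi N0 scale0r !metric0l.
    rewrite (metricC g X 0) (metricC g xi 0) (metricC g (Q X) 0) !metric0l.
    by rewrite !mulr0 !scale0r !scaler0 subrr scaler0 !addr0.
  have -> : L X xi = a5 a *: Q X + (a7 a * r) *: (g X xi *: xi - X).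
    rewrite /Tcurv from0 !ricci_to_xi ricci_from_xi ricci_op_xi N0 metric_xi_xi.
    by rewrite !mul0r !mulr0 !scale0r !scaler0 !add0r !addr0 mulr1 scale1r.
  rewrite sub0r (curvatureDr hLC) !(curvatureZr hLC) (curvatureDr hLC).
  rewrite (curvatureZr hLC) to0 scaler0 add0r.
  rewrite -[- X]scaleN1r (curvatureZr hLC) scaleN1r.
  by rewrite scalerN addrC => /eqP; rewrite oppr_eq0 => /eqP.
rewrite (curvatureZr hLC) /ricC scalerDl -[RHS]addr0 -{1}e1 -e2.
by rewrite addrACA subrr add0r.
Qed.

(** Tracing [R(_, X) (C Q X) = 0] gives [C g(Q X, Q X) = 0]. *)
Lemma ricci_eq0 X Y : (forall p, ricC a p != 0) -> kappa = 0 -> S X Y = 0.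
Proof.
move=> C0 kappa0; rewrite hQ.
suff -> : Q X = 0 by rewrite metric0l.
apply: (metric_self_eq0 (g := g)); apply: smoothfunE => p.
have : (ricC a * g (Q X) (Q X)) p = 0.
  rewrite -metricZr -hQ.
  rewrite (trace_affine ricci_frames (hS X _ p) (a := 0) (l := fun=> 0) (X := 0)).
  - by rewrite mul0r addr0.
  - by move=> *; rewrite addr0.
  - by move=> *; rewrite mulr0.
  - by move=> Z f; rewrite curvature_ricci_op_eq0 // !mul0r addr0.
by move=> /eqP; rewrite mulf_eq0 (negPf (C0 p)) => /eqP.
Qed.

Lemma ricci_identity X Y : (forall p, ricC a p != 0) ->
  ricC a * S X Y = ricA n kappa a * g X Y + ricB n kappa a * (eta X * eta Y).
Proof.
move=> C0; rewrite !eta_metric.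
have [kappa0|kappa0] := eqVneq kappa 0.
  have N0 : N = 0 by apply: smoothfunE => p; rewrite /= kappa0 mulr0.
  by rewrite ricci_eq0 // /ricA /ricB N0 oppr0 !mul0r mulr0 addr0.
apply: smoothfunE => p; apply: (mulfI kappa0).
by have /(congr1 (fun f : C => f p)) e := nullity_times_ricci X Y; exact: e.
Qed.

End NullityContact.

(** * Division by a nowhere vanishing smooth function *)

Section SmoothInverse.
Context {R : realType} {m : nat}.

(** Induction on [k] with [D (1 / f) = - (1 / f) ^ 2 * D f]. *)
Lemma CkV k (U : set 'rV[R]_m) (f : 'rV[R]_m -> R) : open U ->
  (forall x, U x -> f x != 0) -> Ck k U f -> Ck k U (fun x => (f x)^-1).
Proof.
move=> oU f0; elim: k => [|k IH] [cf df];
  have cV x : U x -> {for x, continuous (fun y => (f y)^-1)} by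
    move=> Ux; exact: (@cvgV _ _ (nbhs x) _ f _ (f0 x Ux) (cf x Ux)).
  by [].
split=> // i; have [di ci] := df i; split.
  by move=> x Ux; apply: derivableV; [exact: f0 | exact: di].
have Hf : Ck k U (fun x => (f x)^-1) by apply/IH/Ck_le.
apply: Ck_ext oU _ (CkM oU (CkM oU (Ck_cst k U (-1)) (CkM oU Hf Hf)) ci) => x Ux.
rewrite deriveV; [|exact: f0|exact: di].
by rewrite !fctE /= mulN1r -expr2 exprVn.
Qed.

Lemma smooth_inverse (M : manifold R m) (f : smoothfun M) :
  (forall p, f p != 0) -> exists f' : smoothfun M, forall p, f' p = (f p)^-1.
Proof.
move=> f0; have fV : (fun p => (f p)^-1) \in smooth_pred (M := M).
  apply/asboolP => c ac k.
  have /asboolP/(_ c ac k) := smoothfunP f.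
  by apply: CkV => [|x _]; [exact: chart_img_open | exact: f0].
by exists (Smoothfun fV).
Qed.

Lemma smooth_mulfI (M : manifold R m) (c f h : smoothfun M) :
  (forall p, c p != 0) -> c * f = c * h -> f = h.
Proof.
move=> c0 cfh; apply: smoothfunE => p; apply: (mulfI (c0 p)).
by have /(congr1 (fun F : smoothfun M => F p)) e := cfh; exact: e.
Qed.

End SmoothInverse.

(** * The Ricci tensor *)

Theorem theorem5 (R : realType) (n : nat) (M : manifold R (2 * n + 1)%N)
    (g : metric M)
    (nabla : vfield M -> vfield M -> vfield M)
    (phi : {linear vfield M -> vfield M}) (xi : vfield M)
    (eta : {linear vfield M -> (smoothfun M)^o}) (kappa : R)
    (S : vfield M -> vfield M -> smoothfun M) (Q : vfield M -> vfield M)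
    (r : smoothfun M)
    (hLC : levi_civita g nabla)
    (hcontact : contact_metric phi xi eta g)
    (hkappa : kappa_nullity nabla xi eta kappa)
    (hS : is_ricci nabla S)
    (hQ : is_ricci_operator g S Q)
    (hr : is_scalar_curvature Q r) :
  (forall a : coefs M,
     T_xi_semisymmetric a g nabla S Q r xi ->
     (forall p, ricC a p != 0) ->
     (forall X Y p,
        S X Y p = ricA n kappa a p / ricC a p * g X Y p
                  + ricB n kappa a p / ricC a p * (eta X p * eta Y p)) /\
     eta_einstein g eta S) /\
  ((0 < n)%N ->
   (forall a : coefs M,
      (exists b0 b1, a = Pstar n b0 b1) \/ a = W1 M n \/ a = W1star M n \/
      a = W2 M n \/ a = W5 M n \/ a = W7 M n ->
      T_xi_semisymmetric a g nabla S Q r xi ->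
      (forall p, ricC a p != 0) ->
      einstein g eta S /\
      forall X Y, S X Y = cstf M (2 * n%:R * kappa) * g X Y) /\
   (forall a : coefs M,
      a = W4 M n \/ a = W6 M n \/ a = W8 M n ->
      T_xi_semisymmetric a g nabla S Q r xi ->
      (forall p, ricC a p != 0) ->
      eta_einstein g eta S /\
      forall X Y, S X Y = cstf M (2 * n%:R * kappa) * (eta X * eta Y))).
Proof.
have ident := ricci_identity hLC hcontact hkappa hS hQ.
split=> [a hT C0|_].
  have SE X Y p : S X Y p = ricA n kappa a p / ricC a p * g X Y p
      + ricB n kappa a p / ricC a p * (eta X p * eta Y p).
    have /(congr1 (fun f : smoothfun M => f p)) e := ident _ _ hT X Y C0.
    apply: (mulfI (C0 p)); rewrite [LHS]e.
    change (ricA n kappa a p * g X Y p + ricB n kappa a p * (eta X p * eta Y p) =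
      ricC a p * (ricA n kappa a p / ricC a p * g X Y p
        + ricB n kappa a p / ricC a p * (eta X p * eta Y p))).
    by field; exact: C0.
  split=> //; have [c cE] := smooth_inverse C0.
  exists (ricA n kappa a * c), (ricB n kappa a * c) => X Y.
  by apply: smoothfunE => p; rewrite SE -cE.
split=> a ha hT C0.
  suff SE X Y : S X Y = cstf M (2 * n%:R * kappa) * g X Y.
    split=> //; exists (cstf M (2 * n%:R * kappa)) => X Y.
    by rewrite SE mul0r addr0.
  apply: (smooth_mulfI C0); rewrite (ident _ _ hT _ _ C0) [RHS]mulrA.
  have [-> ->] : ricA n kappa a = ricC a * cstf M (2 * n%:R * kappa) /\
      ricB n kappa a = 0.
    by case: ha => [[b0 [b1 ->]]|[->|[->|[->|[->|->]]]]];
      rewrite /ricA /ricB /ricC /=; split; ring.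
  by rewrite mul0r addr0.
suff SE X Y : S X Y = cstf M (2 * n%:R * kappa) * (eta X * eta Y).
  split=> //; exists 0, (cstf M (2 * n%:R * kappa)) => X Y.
  by rewrite SE mul0r add0r.
apply: (smooth_mulfI C0); rewrite (ident _ _ hT _ _ C0) [RHS]mulrA.
have [-> ->] : ricA n kappa a = 0 /\
    ricB n kappa a = ricC a * cstf M (2 * n%:R * kappa).
  by case: ha => [->|[->|->]]; rewrite /ricA /ricB /ricC /=; split; ring.
by rewrite mul0r add0r.
Qed.
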